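(* Let $X$ be a smooth complete toric variety of dimension $n$ with $\omega_X^{-1}$ nef, let $\Delta=\{v\in\mathbb R^n:\langle v,v_i\rangle\ge-1\ \forall i\}$ where the $v_i$ are the primitive generators of the rays of its fan, and let $u_0=0,u_1,\dots,u_N$ be the points of $\Delta\cap\mathbb Z^n$. Let $P(a_I)=P(a_1,\dots,a_N)\in\mathbb Z[[a_1,\dots,a_N]]$ be the constant term in $t$ of the expansion $\frac1{1+\sum_{I\ne0}a_It^{u_I}}=\sum_{k\ge0}(-1)^k\big(\sum_{I\neq 0}a_It^{u_I}\big)^k$. Let $p$ be a prime. Then the formal power series $$g(a_I)=\frac{P(a_I)}{P(a_I^p)}$$ lies in $$\varprojlim_{s\to\infty}\mathbb Z_p\big[a_1,\dots,a_N,({}^{(p-1)}P(a_I))^{-1}\big]\big/p^s\,\mathbb Z_p\big[a_1,\dots,a_N,({}^{(p-1)}P(a_I))^{-1}\big]$$ and satisfies the Dwork congruences $$g(a_I)\equiv\frac{{}^{(p^s-1)}P(a_I)}{{}^{(p^{s-1}-1)}P(a_I^p)}\mod p^s\qquad(s\ge1).$$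
   Context: ${}^{(k)}P$ denotes the truncation of $P$ at degree $k$: the sum of the terms of $P$ of total degree at most $k$ in $a_1,\dots,a_N$. $P(a_I^p)$ is $P$ with each $a_I$ replaced by $a_I^p$, and ${}^{(p^{s-1}-1)}P(a_I^p)$ is the truncated polynomial ${}^{(p^{s-1}-1)}P$ evaluated at $(a_1^p,\dots,a_N^p)$. Since $P$ has constant term $1$, the displayed inverse limit is viewed inside $\mathbb Z_p[[a_1,\dots,a_N]]$. ($P$ is the holomorphic period at the large complex structure limit of the anticanonical family $a_0+\sum_{I\ne0}a_It^{u_I}=0$, normalized by $a_0=1$.) *)

(* Defs.v *)
From HB Require Import structures.
From mathcomp Require Import all_boot all_order all_algebra.
From mathcomp Require Import boolp reals mpoly.

Set Implicit Arguments.
Unset Strict Implicit.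
Unset Printing Implicit Defensive.

Import Order.TTheory GRing.Theory Num.Theory.
Local Open Scope ring_scope.

(* The ring of p-adic integers, as the inverse limit of the Z/p^s: an element
   is the sequence of its reductions in [0, p^s[ , s >= 0.  Primality of p is
   part of the type so that the ring is nontrivial. *)
Record padic (p : nat) (p_pr : prime p) := Padic {
  residue : nat -> int;
  residueP : forall s, residue s = (residue s.+1 %% (p ^ s)%N%:Z)%Z }.

Section Padic.
Variables (p : nat) (p_pr : prime p).
Local Notation padic := (padic p_pr).
Implicit Types x y z : padic.

HB.instance Definition _ := gen_eqMixin padic.
HB.instance Definition _ := gen_choiceMixin padic.

Lemma padicP x y : (forall s, residue x s = residue y s) -> x = y.
Proof.
case: x y => [f Hf] [g Hg] /= /funext efg; rewrite efg in Hf *.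
by rewrite (Prop_irrelevance Hf Hg).
Qed.

Lemma residue_mod x s : (residue x s %% (p ^ s)%N%:Z)%Z = residue x s.
Proof. by rewrite residueP modz_mod. Qed.

Let pdvd s : ((p ^ s)%N%:Z %| (p ^ s.+1)%N%:Z)%Z.
Proof. by rewrite dvdzE /= dvdn_exp2l. Qed.

Let modpS (z : int) s :
  ((z %% (p ^ s.+1)%N%:Z)%Z %% (p ^ s)%N%:Z)%Z = (z %% (p ^ s)%N%:Z)%Z.
Proof.
have /dvdzP [q Eq] := pdvd s.
have e := divz_eq z (p ^ s.+1)%N%:Z.
by rewrite [in RHS]e [X in (_ * X + _)%R]Eq mulrA modzMDl.
Qed.

Definition padic_of_int (z : int) : padic :=
  @Padic p p_pr (fun s => (z %% (p ^ s)%N%:Z)%Z) (fun s => esym (modpS z s)).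

Let addP (x y : padic) s : ((residue x s + residue y s) %% (p ^ s)%N%:Z)%Z =
  (((residue x s.+1 + residue y s.+1) %% (p ^ s.+1)%N%:Z)%Z %% (p ^ s)%N%:Z)%Z.
Proof. by rewrite modpS (residueP x s) (residueP y s) modzDm. Qed.

Let mulP (x y : padic) s : ((residue x s * residue y s) %% (p ^ s)%N%:Z)%Z =
  (((residue x s.+1 * residue y s.+1) %% (p ^ s.+1)%N%:Z)%Z %% (p ^ s)%N%:Z)%Z.
Proof. by rewrite modpS (residueP x s) (residueP y s) modzMm. Qed.

Let oppP (x : padic) s : ((- residue x s) %% (p ^ s)%N%:Z)%Z =
  (((- residue x s.+1) %% (p ^ s.+1)%N%:Z)%Z %% (p ^ s)%N%:Z)%Z.
Proof. by rewrite modpS (residueP x s) modzNm. Qed.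

Definition padic_add x y : padic := Padic p_pr (addP x y).
Definition padic_mul x y : padic := Padic p_pr (mulP x y).
Definition padic_opp x : padic := Padic p_pr (oppP x).

Fact padic_addA : associative padic_add.
Proof. by move=> x y z; apply/padicP => s /=; rewrite modzDmr modzDml addrA. Qed.
Fact padic_addC : commutative padic_add.
Proof. by move=> x y; apply/padicP => s /=; rewrite addrC. Qed.
Fact padic_add0 : left_id (padic_of_int 0) padic_add.
Proof. by move=> x; apply/padicP => s /=; rewrite modzDml add0r residue_mod. Qed.
Fact padic_addN : left_inverse (padic_of_int 0) padic_opp padic_add.
Proof. by move=> x; apply/padicP => s /=; rewrite modzDml addNr. Qed.

HB.instance Definition _ :=
  GRing.isZmodule.Build padic padic_addA padic_addC padic_add0 padic_addN.

Fact padic_mulA : associative padic_mul.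
Proof. by move=> x y z; apply/padicP => s /=; rewrite modzMmr modzMml mulrA. Qed.
Fact padic_mulC : commutative padic_mul.
Proof. by move=> x y; apply/padicP => s /=; rewrite mulrC. Qed.
Fact padic_mul1 : left_id (padic_of_int 1) padic_mul.
Proof. by move=> x; apply/padicP => s /=; rewrite modzMml mul1r residue_mod. Qed.
Fact padic_mulD : left_distributive padic_mul +%R.
Proof.
by move=> x y z; apply/padicP => s /=; rewrite modzMml modzDm mulrDl.
Qed.
Fact padic_1neq0 : padic_of_int 1 != 0 :> padic.
Proof.
apply/eqP => /(congr1 (fun x => residue x 1)) /=.
by rewrite expn1 mod0z modz_small //= ltz_nat prime_gt1.
Qed.

HB.instance Definition _ := GRing.Zmodule_isComNzRing.Build padic
  padic_mulA padic_mulC padic_mul1 padic_mulD padic_1neq0.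

End Padic.

(* Formal power series in N variables. *)
Record mseries (N : nat) (R : Type) := MSeries { mscoef : 'X_{1..N} -> R }.

Section Series.
Variables (N : nat) (R : comNzRingType).
Local Notation S := (mseries N R).
Implicit Types (f g h : S) (m : 'X_{1..N}).

HB.instance Definition _ := gen_eqMixin S.
HB.instance Definition _ := gen_choiceMixin S.

Lemma mseriesP f g : mscoef f =1 mscoef g -> f = g.
Proof. by case: f g => [f] [g] /= /funext ->. Qed.

Definition series_of_mpoly (q : {mpoly R[N]}) : S := MSeries (fun m => q@_m).

(* The sum of the terms of total degree at most k. *)
Definition mstrunc (k : nat) f : {mpoly R[N]} :=
  \sum_(m : 'X_{1..N < k.+1}) mscoef f m *: 'X_[m].

Lemma mstruncE k f m :
  (mstrunc k f)@_m = if (mdeg m <= k)%N then mscoef f m else 0.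
Proof.
rewrite /mstrunc raddf_sum /=.
under eq_bigr do rewrite mcoeffZ mcoeffX.
case: leqP => [le_mk|lt_km].
  rewrite (bigD1 (BMultinom (le_mk : (mdeg m < k.+1)%N))) //= eqxx mulr1.
  rewrite big1 ?addr0 // => i; rewrite -val_eqE /= => /negPf ->.
  by rewrite mulr0.
rewrite big1 // => i _; case: eqP => [e|_]; last by rewrite mulr0.
by move: (bmdeg i); rewrite e ltnS leqNgt lt_km.
Qed.

Definition msadd f g := MSeries (fun m => mscoef f m + mscoef g m).
Definition msopp f := MSeries (fun m => - mscoef f m).
Definition msmul f g := MSeries (fun m =>
  \sum_(k : 'X_{1..N < (mdeg m).+1, (mdeg m).+1} | m == (k.1 + k.2)%MM)
    mscoef f k.1 * mscoef g k.2).

Lemma mcoeffM_congr (p p' q q' : {mpoly R[N]}) m :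
    (forall k, (mdeg k <= mdeg m)%N -> p@_k = p'@_k) ->
    (forall k, (mdeg k <= mdeg m)%N -> q@_k = q'@_k) ->
  (p * q)@_m = (p' * q')@_m.
Proof.
move=> ep eq; rewrite !mcoeffM; apply: eq_bigr => k _.
by rewrite ep ?eq // -ltnS bmdeg.
Qed.

Lemma mscoef_mul f g m :
  mscoef (msmul f g) m = (mstrunc (mdeg m) f * mstrunc (mdeg m) g)@_m.
Proof.
rewrite mcoeffM /=; apply: eq_bigr => k _.
by rewrite !mstruncE !(ltnSE (bmdeg _)).
Qed.

Lemma mstrunc_mul d f g k : (mdeg k <= d)%N ->
  (mstrunc d (msmul f g))@_k = (mstrunc d f * mstrunc d g)@_k.
Proof.
move=> le_kd; rewrite mstruncE le_kd mscoef_mul.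
by apply: mcoeffM_congr => l le_lk; rewrite !mstruncE le_lk (leq_trans le_lk).
Qed.

Fact msaddA : associative msadd.
Proof. by move=> f g h; apply/mseriesP => m /=; rewrite addrA. Qed.
Fact msaddC : commutative msadd.
Proof. by move=> f g; apply/mseriesP => m /=; rewrite addrC. Qed.
Fact msadd0 : left_id (series_of_mpoly 0) msadd.
Proof. by move=> f; apply/mseriesP => m /=; rewrite mcoeff0 add0r. Qed.
Fact msaddN : left_inverse (series_of_mpoly 0) msopp msadd.
Proof. by move=> f; apply/mseriesP => m /=; rewrite mcoeff0 addNr. Qed.

HB.instance Definition _ := GRing.isZmodule.Build S msaddA msaddC msadd0 msaddN.

Fact msmulA : associative msmul.
Proof.
move=> f g h; apply/mseriesP => m; rewrite !mscoef_mul.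
rewrite (mcoeffM_congr (fun _ _ => erefl) (@mstrunc_mul _ _ _)) mulrA.
by apply: esym; apply: mcoeffM_congr => // k; exact: mstrunc_mul.
Qed.
Fact msmulC : commutative msmul.
Proof. by move=> f g; apply/mseriesP => m; rewrite !mscoef_mul mulrC. Qed.
Fact msmul1 : left_id (series_of_mpoly 1) msmul.
Proof.
move=> f; apply/mseriesP => m; rewrite mscoef_mul.
rewrite (@mcoeffM_congr _ 1 _ (mstrunc (mdeg m) f)) ?mul1r ?mstruncE ?leqnn //.
by move=> k le_k; rewrite mstruncE le_k.
Qed.
Fact msmulD : left_distributive msmul +%R.
Proof.
move=> f g h; apply/mseriesP => m /=; rewrite -big_split /=.
by apply: eq_bigr => k _; rewrite mulrDl.
Qed.
Fact ms1_neq0 : series_of_mpoly 1 != 0 :> S.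
Proof.
apply/eqP => /(congr1 (fun f => mscoef f 0%MM)) /=.
by move/eqP; rewrite mcoeff0 mcoeff1 eqxx oner_eq0.
Qed.

HB.instance Definition _ := GRing.Zmodule_isComNzRing.Build S
  msmulA msmulC msmul1 msmulD ms1_neq0.

(* For f with constant term 1, f^-1 = \sum_k (1 - f)^k; the terms with
   k > mdeg m do not contribute to the coefficient of a^m. *)
Definition msinv f : S :=
  MSeries (fun m => \sum_(k < (mdeg m).+1) mscoef ((1 - f) ^+ k) m).

(* f(a_1^p, ..., a_N^p) *)
Definition mspow (p : nat) f : S := MSeries (fun m =>
  if [forall i, (p %| m i)%N] then mscoef f [multinom (m i %/ p)%N | i < N] else 0).

Lemma mscoefD f g m : mscoef (f + g) m = mscoef f m + mscoef g m.
Proof. by []. Qed.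

Lemma mscoef_sum (I : finType) (F : I -> S) m :
  mscoef (\sum_i F i) m = \sum_i mscoef (F i) m.
Proof.
elim/big_rec2: _ => [|i x y _ <-]; [exact: mcoeff0 | exact: mscoefD].
Qed.

Lemma mscoefX_eq0 f k m :
  mscoef f 0%MM = 0 -> (mdeg m < k)%N -> mscoef (f ^+ k) m = 0.
Proof.
move=> f0; elim: k m => // k IHk m lt_mk; rewrite exprS.
rewrite [LHS]big1 // => -[[k1 b1] [k2 b2]] /= /eqP e.
have [->|k1N0] := eqVneq k1 0%MM; first by rewrite f0 mul0r.
rewrite IHk ?mulr0 // -ltnS; apply: leq_trans lt_mk.
by rewrite e mdegD !ltnS -[X in (X < _)%N]add0n ltn_add2r lt0n mdeg_eq0.
Qed.

Lemma msmulV f : mscoef f 0%MM = 1 -> f * msinv f = 1.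
Proof.
move=> f0; apply/mseriesP => m.
have x0 : mscoef (1 - f) 0%MM = 0.
  by rewrite mscoefD /= f0 mcoeff1 eqxx subrr.
pose T := \sum_(k < (mdeg m).+1) (1 - f) ^+ k.
have -> : mscoef (f * msinv f) m = mscoef (f * T) m.
  apply: eq_bigr => k /eqP e; congr (_ * _); rewrite mscoef_sum /=.
  rewrite (big_ord_widen _ (fun i => mscoef ((1 - f) ^+ i) k.2) (bmdeg k.2)).
  rewrite big_mkcond; apply: eq_bigr => i _; case: leqP => // lt_i.
  by rewrite mscoefX_eq0.
have -> : f * T = 1 - (1 - f) ^+ (mdeg m).+1.
  by rewrite -[X in X - _](expr1n _ (mdeg m).+1) subrXX /T opprB addrCA subrr addr0;
     congr (_ * _); apply: eq_bigr => i _; rewrite expr1n mul1r.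
by rewrite mscoefD /= mscoefX_eq0 // oppr0 addr0.
Qed.

(* f lies in R[a, h^-1], seen in R[[a]] when h has constant term 1. *)
Definition in_localization (h : {mpoly R[N]}) f : Prop :=
  exists (q : {mpoly R[N]}) (k : nat),
    series_of_mpoly h ^+ k * f = series_of_mpoly q.

(* f = g modulo c A *)
Definition congr_mod (A : S -> Prop) (c : nat) f g : Prop :=
  exists2 d, A d & f - g = d *+ c.

(* g lies in the inverse limit of the A / p^s A with A = R[a, h^-1]: there is
   a compatible family of classes of f s in A / p^s A whose image in the inverse
   limit of the R[[a]] / p^s R[[a]] is g. *)
Definition in_completed_localization (p : nat) (h : {mpoly R[N]}) g : Prop :=
  exists f : nat -> S,
    [/\ forall s, in_localization h (f s),
        forall s, congr_mod (in_localization h) (p ^ s) (f s.+1) (f s)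
      & forall s, congr_mod (fun=> True) (p ^ s) g (f s)].

End Series.

Definition map_mseries (N : nat) (R R' : Type) (phi : R -> R')
  (f : mseries N R) : mseries N R' := MSeries (fun m => phi (mscoef f m)).

(* Coefficients, indexed by the exponent of t, of the powers of the Laurent
   polynomial \sum_I a_I t^{u_I}; multiplication by a_I t^{u_I} multiplies
   coefficients by a_I and shifts exponents by u_I. *)
Fixpoint laurent_pow (n N : nat) (u : 'I_N -> 'rV[int]_n) (k : nat)
    (w : 'rV[int]_n) : {mpoly int[N]} :=
  if k is k'.+1 then \sum_(I < N) 'X_I * laurent_pow u k' (w - u I)
  else (w == 0)%:R.

(* The constant term in t of \sum_k (-1)^k (\sum_I a_I t^{u_I})^k.  The k-th
   summand is homogeneous of degree k in a, so only k <= mdeg m can contribute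
   to the coefficient of a^m. *)
Definition period (n N : nat) (u : 'I_N -> 'rV[int]_n) : mseries N int :=
  MSeries (fun m => \sum_(k < (mdeg m).+1) (-1) ^+ k * (laurent_pow u k 0)@_m).

(* Fans in R^n with respect to the lattice Z^n: ray i is the primitive
   generator of the i-th ray, and a cone is given by the set of its rays. *)
Record fan_data (n : nat) := FanData {
  nrays : nat;
  ray : 'I_nrays -> 'rV[int]_n;
  cones : {set {set 'I_nrays}} }.

Definition dotv (K : pzRingType) (n : nat) (x y : 'rV[K]_n) : K :=
  \sum_i x 0 i * y 0 i.

Definition primitive (n : nat) (v : 'rV[int]_n) : Prop :=
  forall (k : nat) (w : 'rV[int]_n), v = w *+ k -> k = 1%N.

Section Fan.
Variables (R : realType) (n : nat) (X : fan_data n).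
Implicit Types (s t : {set 'I_(nrays X)}) (C F : 'rV[R]_n -> Prop).

Definition realv (v : 'rV[int]_n) : 'rV[R]_n := map_mx intr v.

Definition cone s (x : 'rV[R]_n) : Prop :=
  exists2 c : 'I_(nrays X) -> R,
    forall i, 0 <= c i & x = \sum_(i in s) c i *: realv (ray i).

Definition is_face F C : Prop :=
  exists2 m : 'rV[R]_n, forall x, C x -> 0 <= dotv m x
    & forall x, F x <-> C x /\ dotv m x = 0.

(* The last clause for the pair {i}, s forces the rays listed in a cone s to be
   exactly its extremal rays. *)
Definition is_fan : Prop :=
  [/\ injective (@ray n X) /\ (forall i, primitive (@ray n X i)),
      forall i, [set i] \in cones X,
      forall s x, s \in cones X -> cone s x -> cone s (- x) -> x = 0,
      forall s F, s \in cones X -> is_face F (cone s) ->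
        exists2 t, t \in cones X & forall x, F x <-> cone t x
    & forall s t, s \in cones X -> t \in cones X ->
        is_face (fun x => cone s x /\ cone t x) (cone s)].

(* The toric variety is smooth: every cone is generated by a part of a basis
   of Z^n, here the rows of B. *)
Definition smooth_fan : Prop :=
  forall s, s \in cones X ->
    exists (B : 'M[int]_n) (f : 'I_(nrays X) -> 'I_n),
      [/\ B \in unitmx, {in s &, injective f}
        & {in s, forall i, ray i = row (f i) B}].

Definition complete_fan : Prop :=
  forall x : 'rV[R]_n, exists2 s, s \in cones X & cone s x.

(* {v in R^n | <v, v_i> >= -1 for all i} *)
Definition anticanonical_polytope (v : 'rV[R]_n) : Prop :=
  forall i : 'I_(nrays X), -1 <= dotv v (realv (ray i)).

End Fan.

Section Nef.
Variables (n : nat) (X : fan_data n).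

(* d is the intersection number of D = \sum_i a_i D_i with the torus-invariant
   curve C = V(s :&: t), where s and t are n-dimensional cones of a smooth
   complete fan meeting in a wall and j is the ray of t not in s: if
   <m, v_i> = - a_i on s, then D is linearly equivalent to
   \sum_i (a_i + <m, v_i>) D_i, where the D_i with i in s have coefficient 0 and
   D_j is the only other one meeting C, transversally in one point. *)
Definition curve_intersection (a : 'I_(nrays X) -> int)
    (s t : {set 'I_(nrays X)}) (d : int) : Prop :=
  exists (m : 'rV[int]_n) (j : 'I_(nrays X)),
    [/\ {in s, forall i, dotv m (ray i) = - a i}, j \in t :\: s
      & d = a j + dotv m (ray j)].

Definition nef_divisor (a : 'I_(nrays X) -> int) : Prop :=
  forall s t d, s \in cones X -> t \in cones X ->
    #|s| = n -> #|t| = n -> #|s :&: t|.+1 = n ->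
    curve_intersection a s t d -> 0 <= d.

(* The anticanonical divisor is the sum of all the torus-invariant prime
   divisors. *)
Definition anticanonical_nef : Prop := nef_divisor (fun=> 1).

End Nef.

(* Main.v *)
Require Import Defs.
From HB Require Import structures.
From mathcomp Require Import all_boot all_order all_algebra.
From mathcomp Require Import boolp reals mpoly.
From mathcomp Require Import zify ring.

(** Put [x = - sum_I a_I t^{u_I}], [G_s = sum_(n < p^s) x^n], and let [phi_l]
    raise all the variables to the power [p^l].  Since [phi_1 x = x^p] modulo
    [p], the elements [A_i] defined recursively by
      [G_s = sum_(i < s) A_i phi_(i+1)(G_(s-i-1))]
    are divisible by [p^i].  As [A_i] has degree less than [p^(i+1)] in [a] and
    the origin is the only interior lattice point of the polytope, the constant
    term in [t] of each summand is the product of the constant terms of its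
    factors; so the truncations [P_s] of the period satisfy
      [P_s = sum_(i < s) C_i phi_(i+1)(P_(s-i-1))] with [p^i] dividing [C_i].
    Iterating, [P_s] is a sum over the compositions of [s], and exchanging tails
    of compositions yields
      [P_s phi_1(P_(r-1)) = P_r phi_1(P_(s-1))] modulo [p^s] for [1 <= s <= r].
    Letting [r] go to infinity gives the congruences in [Z_p[[a]]].  Modulo [p]
    the recursion makes [P_s] a power of [P_1], whence the convergence in the
    completion of [Z_p[a, 1/P_1]]; both that ring and its completion are
    [p]-saturated in [Z_p[[a]]], so the congruences hold there too. *)

Set Implicit Arguments.
Unset Strict Implicit.
Unset Printing Implicit Defensive.

Import Order.TTheory GRing.Theory Num.Theory.
Local Open Scope ring_scope.

(** * Congruences in commutative rings *)

Definition divn_by (B : nmodType) (c : nat) (x : B) : Prop :=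
  exists y, x = y *+ c.

Section DivnByZmod.
Variable B : zmodType.
Implicit Types (x y : B) (c d : nat).

Lemma divn_by0 c : divn_by c (0 : B).
Proof. by exists 0; rewrite mul0rn. Qed.

Lemma divn_byD c x y : divn_by c x -> divn_by c y -> divn_by c (x + y).
Proof. by move=> [a ->] [b ->]; exists (a + b); rewrite mulrnDl. Qed.

Lemma divn_byN c x : divn_by c x -> divn_by c (- x).
Proof. by move=> [a ->]; exists (- a); rewrite mulNrn. Qed.

Lemma divn_byB c x y : divn_by c x -> divn_by c y -> divn_by c (x - y).
Proof. by move=> hx /divn_byN; exact: divn_byD. Qed.

Lemma divn_by_sum c (I : Type) (r : seq I) (Q : pred I) (F : I -> B) :
  (forall i, Q i -> divn_by c (F i)) -> divn_by c (\sum_(i <- r | Q i) F i).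
Proof.
by move=> hF; apply: big_ind => //; [exact: divn_by0 | exact: divn_byD].
Qed.

Lemma divn_by_dvdn c d x : (d %| c)%N -> divn_by c x -> divn_by d x.
Proof.
by move=> /dvdnP [q ->] [y ->]; exists (y *+ q); rewrite mulrnA.
Qed.

Lemma divn_by_exp p k l x :
  (l <= k)%N -> divn_by (p ^ k) x -> divn_by (p ^ l) x.
Proof. by move=> le_lk; apply: divn_by_dvdn; exact: dvdn_exp2l. Qed.

Lemma divn_by_trans c x y z :
  divn_by c (x - y) -> divn_by c (y - z) -> divn_by c (x - z).
Proof.
by move=> h1 h2; rewrite -(subrK y x) -addrA; exact: divn_byD.
Qed.

Lemma divn_by_sym c x y : divn_by c (x - y) -> divn_by c (y - x).
Proof. by move=> /divn_byN; rewrite opprB. Qed.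

End DivnByZmod.

Section DivnByRing.
Variable B : comNzRingType.
Implicit Types (x y z : B) (c d : nat).

Lemma divn_byM c d x y :
  divn_by c x -> divn_by d y -> divn_by (c * d) (x * y).
Proof.
by move=> [a ->] [b ->]; exists (a * b); rewrite mulrnAl mulrnAr -mulrnA mulnC.
Qed.

Lemma divn_byMl c z x : divn_by c x -> divn_by c (z * x).
Proof. by move=> [a ->]; exists (z * a); rewrite mulrnAr. Qed.

Lemma divn_byMr c z x : divn_by c x -> divn_by c (x * z).
Proof. by rewrite mulrC; exact: divn_byMl. Qed.

Lemma divn_by_subX c x y n : divn_by c (x - y) -> divn_by c (x ^+ n - y ^+ n).
Proof. by rewrite subrXX; exact: divn_byMr. Qed.

Lemma divn_by_subM c x y x' y' :
  divn_by c (x - x') -> divn_by c (y - y') -> divn_by c (x * y - x' * y').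
Proof.
move=> hx hy; have -> : x * y - x' * y' = (x - x') * y + x' * (y - y').
  by rewrite mulrBl mulrBr addrA subrK.
by apply: divn_byD; [exact: divn_byMr | exact: divn_byMl].
Qed.

(** Modulo [x - y] the cofactor of [x - y] in [x ^+ p - y ^+ p] is [p] times a power of [y], which
    contributes one more factor [p]. *)
Lemma divn_by_subXp p k x y :
  divn_by (p ^ k.+1) (x - y) -> divn_by (p ^ k.+2) (x ^+ p - y ^+ p).
Proof.
move=> h; rewrite subrXX expnSr; apply: divn_byM => //.
case: p h => [|p] h; first by rewrite big_ord0; exact: divn_by0.
have -> : \sum_(i < p.+1) x ^+ (p.+1.-1 - i) * y ^+ i =
  \sum_(i < p.+1) (x ^+ (p - i) - y ^+ (p - i)) * y ^+ i + y ^+ p *+ p.+1.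
  rewrite -[X in y ^+ p *+ X](card_ord p.+1) -sumr_const -big_split /=.
  apply: eq_bigr => i _; rewrite mulrBl -exprD subnK ?subrK //.
  by rewrite -ltnS.
apply: divn_byD; last by exists (y ^+ p).
apply: divn_by_sum => i _; apply/divn_byMr/divn_by_subX.
by move: h; apply: divn_by_dvdn; rewrite expnS dvdn_mulr.
Qed.

Lemma divn_by_subXpX p k l x y :
  divn_by (p ^ l.+1) (x - y) ->
  divn_by (p ^ (l + k).+1) (x ^+ (p ^ k) - y ^+ (p ^ k)).
Proof.
move=> h; elim: k => [|k IHk]; first by rewrite addn0 !expr1.
by rewrite addnS [(p ^ k.+1)%N]expnSr !exprM; exact: divn_by_subXp.
Qed.

Lemma divn_by_subXD p x y : prime p ->
  divn_by p ((x + y) ^+ p - (x ^+ p + y ^+ p)).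
Proof.
case: p => // p p_pr; rewrite exprDn big_ord_recl big_ord_recr /=.
rewrite subn0 bin0 expr0 mulr1 mulr1n /bump leq0n add1n subnn expr0 mul1r binn.
rewrite mulr1n; set S := \sum_(i < p) _.
have -> : x ^+ p.+1 + (S + y ^+ p.+1) - (x ^+ p.+1 + y ^+ p.+1) = S by ring.
apply: divn_by_sum => i _; rewrite leq0n add1n.
have /dvdnP [q ->] : (p.+1 %| 'C(p.+1, i.+1))%N.
  by apply: prime_dvd_bin => //=; rewrite ltnS.
by rewrite mulrnA; exists (x ^+ (p.+1 - i.+1) * y ^+ i.+1 *+ q).
Qed.

Lemma divn_by_sub_quot c (a b d e d' e' : B) : d * d' = 1 -> e * e' = 1 ->
  divn_by c (a * e - b * d) -> divn_by c (a * d' - b * e').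
Proof.
move=> dV eV h; have -> : a * d' - b * e' = d' * e' * (a * e - b * d).
  rewrite -[a in LHS]mulr1 -eV -[b in LHS]mulr1 -dV; ring.
exact: divn_byMl.
Qed.

End DivnByRing.

Lemma divn_by_morph (B B' : comNzRingType) (f : {additive B -> B'}) c x :
  divn_by c x -> divn_by c (f x).
Proof. by move=> [y ->]; exists (f y); rewrite raddfMn. Qed.

(** * Lifts of the Frobenius modulo [p] *)

Section FrobeniusLift.
Variables (B : comNzRingType) (p : nat) (p_pr : prime p).
Variable phi : {rmorphism B -> B}.

(** For [p] prime these elements form a subring, so only generators need checking. *)
Definition frob_lift (x : B) := divn_by p (phi x - x ^+ p).

Lemma frob_liftD x y : frob_lift x -> frob_lift y -> frob_lift (x + y).
Proof.
move=> hx hy; rewrite /frob_lift rmorphD.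
apply: divn_by_trans (divn_by_sym (divn_by_subXD x y p_pr)).
by rewrite opprD addrACA; exact: divn_byD.
Qed.

Lemma frob_liftM x y : frob_lift x -> frob_lift y -> frob_lift (x * y).
Proof.
by move=> hx hy; rewrite /frob_lift rmorphM exprMn; exact: divn_by_subM.
Qed.

Lemma frob_lift0 : frob_lift 0.
Proof.
rewrite /frob_lift rmorph0 expr0n eqn0Ngt prime_gt0 // subr0; exact: divn_by0.
Qed.

Lemma frob_lift1 : frob_lift 1.
Proof. by rewrite /frob_lift rmorph1 expr1n subrr; exact: divn_by0. Qed.

Lemma frob_liftN x : frob_lift x -> frob_lift (- x).
Proof.
have hN1 : frob_lift (-1).
  (* For [p = 2] the two sides differ by [-2]; for odd [p] they are equal. *)
  rewrite /frob_lift rmorphN1; case: (even_prime p_pr) => [->|podd].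
    by exists (-1); rewrite expr2 mulrNN mulr1 -opprD mulNrn.
  by rewrite -signr_odd podd expr1 subrr; exact: divn_by0.
by rewrite -mulN1r => hx; exact: frob_liftM.
Qed.

Lemma frob_lift_sum (I : Type) (r : seq I) (Q : pred I) (F : I -> B) :
  (forall i, Q i -> frob_lift (F i)) -> frob_lift (\sum_(i <- r | Q i) F i).
Proof.
by move=> hF; apply: big_ind => //; [exact: frob_lift0 | exact: frob_liftD].
Qed.

Lemma frob_lift_int (z : int) : frob_lift z%:~R.
Proof.
have hn (m : nat) : frob_lift m%:R.
  by elim: m => [|m IHm]; [exact: frob_lift0
                          | rewrite mulrS; exact: frob_liftD frob_lift1 IHm].
by case: z => m; [exact: hn | rewrite NegzE mulrNz; exact/frob_liftN/hn].
Qed.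

End FrobeniusLift.

(** * Decomposition of geometric sums *)

Definition geom_sum (B : comNzRingType) (x : B) (n : nat) : B :=
  \sum_(0 <= i < n) x ^+ i.

Lemma geom_sum1 (B : comNzRingType) (x : B) : geom_sum x 1 = 1.
Proof. by rewrite /geom_sum big_nat1 expr0. Qed.

Lemma geom_sumM (B : comNzRingType) (x : B) (m n : nat) :
  geom_sum x (m * n) = geom_sum x n * geom_sum (x ^+ n) m.
Proof.
rewrite /geom_sum big_nat_mul big_distrr /=; apply: eq_bigr => i _.
rewrite -{1}[(i * n)%N]add0n big_addn -mulnBl subSnn mul1n mulr_suml.
by apply: eq_bigr => j _; rewrite exprD mulnC exprM.
Qed.

Lemma rmorph_geom_sum (B B' : comNzRingType) (f : {rmorphism B -> B'}) x n :
  f (geom_sum x n) = geom_sum (f x) n.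
Proof. by rewrite rmorph_sum; apply: eq_bigr => i _; rewrite rmorphXn. Qed.

Section Decomposition.
Variables (B : comNzRingType) (p : nat) (phi : nat -> {rmorphism B -> B}).
Hypothesis phi0 : forall y, phi 0 y = y.
Hypothesis phiS : forall l y, phi l.+1 y = phi 1 (phi l y).
Variable x : B.
Hypothesis phi_x : frob_lift p (phi 1) x.

Local Notation G s := (geom_sum x (p ^ s)).

Lemma phi_frob l : divn_by p (phi l x - x ^+ (p ^ l)).
Proof.
elim: l => [|l IHl]; first by rewrite phi0 expr1 subrr; exact: divn_by0.
rewrite phiS; apply: (@divn_by_trans _ _ _ (phi 1 (x ^+ (p ^ l)))).
  by rewrite -rmorphB; exact: divn_by_morph.
by rewrite rmorphXn expnS exprM; exact: divn_by_subX.
Qed.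

(** In the identity for [G s] the last coefficient multiplies [phi s (G 0) = 1], so the identity can
    be solved for it. *)
Lemma geom_sum_decomp S : exists A : nat -> B,
  (forall s, (0 < s <= S)%N ->
     G s = \sum_(i < s) A i * phi i.+1 (G (s - i.+1))) /\
  forall i, (i < S)%N -> divn_by (p ^ i) (A i).
Proof.
elim: S => [|S [A [decA divA]]].
  by exists (fun=> 0); split => [[]|].
pose rest := \sum_(i < S) A i * phi i.+1 (G (S.+1 - i.+1)).
pose A' i := if i == S then G S.+1 - rest else A i.
have A'E i : (i < S)%N -> A' i = A i by rewrite /A'; case: ltngtP.
exists A'; split=> [s /andP [s_gt0]|i].
  rewrite leq_eqVlt => /orP [/eqP ->|lt_sS].
  - rewrite big_ord_recr /= {2}/A' eqxx subnn rmorph_geom_sum.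
    rewrite expn0 geom_sum1 mulr1.
    under eq_bigr => i _ do rewrite A'E //.
    by rewrite addrC subrK.
  - rewrite decA ?s_gt0 //; apply: eq_bigr => i _.
    by rewrite A'E // (leq_trans (ltn_ord i)).
rewrite ltnS leq_eqVlt => /orP [/eqP ->|lt_iS]; last first.
  by rewrite A'E //; exact: divA.
rewrite /A' eqxx; case: (posnP S) => [S0|S_gt0].
  by rewrite {1}S0 expn0; exists (G S.+1 - rest).
have -> : G S.+1 = G S * geom_sum (x ^+ (p ^ S)) p by rewrite expnS geom_sumM.
(* Once [G S] is expanded by induction, [G S.+1 - rest] is a sum of terms
   [A i * phi i.+1 (G (S - i.+1))] times a difference of two geometric sums of length [p]. *)
rewrite [X in X * _]decA ?S_gt0 ?leqnn // mulr_suml /rest -sumrB.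
apply: divn_by_sum => -[{}i lt_iS] _ /=.
rewrite subSn // expnS geom_sumM rmorphM /= mulrA -mulrBr.
rewrite -[X in divn_by (p ^ X)](subnKC (ltnW lt_iS)) expnD.
apply: divn_byM; first by apply: divn_byMr; exact: divA.
rewrite rmorph_geom_sum rmorphXn -sumrB; apply: divn_by_sum => d _.
apply/divn_by_subX/divn_by_sym.
(* [phi i.+1 x] and [x ^+ (p ^ i.+1)] agree modulo [p], so their powers of exponent [p ^ (S - i.+1)]
   agree modulo [p ^ (S - i)]; the factor [p ^ i] of [A i] supplies the rest of [p ^ S]. *)
have -> : (p ^ S = p ^ i.+1 * p ^ (S - i.+1))%N by rewrite -expnD subnKC.
rewrite exprM -[(S - i)%N]add0n -subSS subSn // addnS.
by apply: divn_by_subXpX; rewrite expn1; exact: phi_frob.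
Qed.

End Decomposition.

(* [T i j] counts the compositions of the interval [i, j] with weights [C] on
   the blocks.  Exchanging the tails of two compositions at a common break point
   shows that only pairs without common break point contribute to the
   determinant; these have long blocks.  The induction carries this out. *)
Lemma composition_det (B : comNzRingType) (p r : nat) (T C : nat -> nat -> B) :
    (forall i j, (i < j <= r)%N ->
       T i j = \sum_(i <= k < j) C i k * T k.+1 j) ->
    (forall i k, (i <= k < r)%N -> divn_by (p ^ (k - i)) (C i k)) ->
  forall i j s, (i < j)%N -> (j <= s <= r)%N ->
    divn_by (p ^ (s - j).+1) (T i s * T j r - T i r * T j s).
Proof.
move=> TE C_div i j s lt_ij /andP [le_js le_sr].
have [m] := ubnP (s - i); elim: m i j lt_ij le_js => // m IHm i j lt_ij le_js.
move=> lt_m; have lt_is := leq_trans lt_ij le_js.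
rewrite (TE i s) ?lt_is // (TE i r) ?(leq_trans lt_is) ?leqnn //.
(* First blocks of [[i, r]] with [k >= s] are long enough by themselves: [k - i >= s - j + 1]. *)
rewrite (@big_cat_nat _ _ _ s i r) ?(ltnW lt_is) //=.
rewrite mulrDl opprD addrA; apply: divn_byD; last first.
  apply/divn_byN/divn_byMr; rewrite big_nat_cond.
  apply: divn_by_sum => k /andP [/andP [le_sk lt_kr] _]; apply: divn_byMr.
  apply: (@divn_by_exp _ _ (k - i)); first lia.
  by apply: C_div; rewrite lt_kr andbT; lia.
rewrite !mulr_suml -sumrB big_nat_cond.
apply: divn_by_sum => k /andP [/andP [le_ik lt_ks] _].
rewrite -!mulrA -mulrBr.
have hC : divn_by (p ^ (k - i)) (C i k) by apply: C_div; lia.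
(* Compare the first break point [k.+1] with [j]: before [j], induct; past [j], exchange the two
   roles and add the exponents; at [j], the terms cancel. *)
case: (ltngtP k.+1 j) => [lt_kj|lt_jk|->].
- by apply: divn_byMl; apply: IHm => //; lia.
- apply: (@divn_by_exp _ _ ((k - i) + (s - k.+1).+1)); first lia.
  rewrite expnD; apply: divn_byM => //; apply/divn_by_sym.
  by rewrite ![T k.+1 _ * _]mulrC; apply: IHm => //; lia.
- by rewrite [X in _ - X]mulrC subrr mulr0; exact: divn_by0.
Qed.

(** * Constant terms and truncated periods *)

Section Frob.
Variables (N : nat) (R : comNzRingType).
Implicit Types (f g : {mpoly R[N]}) (m k : 'X_{1..N}) (q : nat).

(** When a monomial also carries a power of [t], as in the variables [a_I t^{u_I}] below, this
    raises both the [a_I] and [t] to the power [q]. *)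
Definition frob q f : {mpoly R[N]} := f \mPo [tuple 'X_I ^+ q | I < N].

HB.instance Definition _ q :=
  GRing.RMorphism.copy (frob q) (comp_mpoly [tuple 'X_I ^+ q | I < N]).

Lemma frobZ q c f : frob q (c *: f) = c *: frob q f.
Proof. exact: comp_mpolyZ. Qed.

Lemma frobX q m : frob q 'X_[m] = 'X_[(m *+ q)].
Proof.
rewrite /frob comp_mpolyX -mpolyXn mpolyXE_id -prodrXl.
by apply: eq_bigr => i _; rewrite tnth_mktuple exprAC.
Qed.

Lemma frobE q f : frob q f = \sum_(m <- msupp f) f@_m *: 'X_[(m *+ q)].
Proof.
rewrite {1}(mpolyE f) raddf_sum /=; apply: eq_bigr => m _.
by rewrite frobZ frobX.
Qed.

Lemma frob_frob q r f : frob q (frob r f) = frob (q * r) f.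
Proof.
rewrite (frobE r) raddf_sum frobE /=; apply: eq_bigr => m _.
rewrite frobZ frobX; congr (_ *: 'X_[_]).
by apply/mnmP => i; rewrite !mulmnE -mulnA [(r * q)%N]mulnC.
Qed.

Lemma frob1 f : frob 1 f = f.
Proof.
rewrite frobE [RHS](mpolyE f); apply: eq_bigr => m _.
by congr (_ *: 'X_[_]); apply/mnmP => i; rewrite mulmnE muln1.
Qed.

Definition mnm_divn q m : 'X_{1..N} := [multinom (m i %/ q)%N | i < N].

Lemma mnm_divnK q m : [forall i, q %| m i]%N -> (mnm_divn q m *+ q)%MM = m.
Proof.
move=> /forallP dvd_m; apply/mnmP => i.
by rewrite mulmnE mnmE divnK.
Qed.

Lemma mcoeff_frob q f m : (0 < q)%N ->
  (frob q f)@_m = if [forall i, q %| m i]%N then f@_(mnm_divn q m) else 0.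
Proof.
move=> q_gt0; rewrite frobE raddf_sum /=.
under eq_bigr => k _ do rewrite mcoeffZ mcoeffX.
case: ifPn => [dvd_m|ndvd_m]; last first.
  rewrite big1 // => k _; case: eqP => [ek|]; last by rewrite mulr0.
  case/negP: ndvd_m; apply/forallP => i.
  by rewrite -ek mulmnE dvdn_mull.
rewrite [in RHS](mpolyE f) raddf_sum /=; apply: eq_bigr => k _.
rewrite mcoeffZ mcoeffX; congr (_ * _%:R); congr nat_of_bool.
rewrite -{1}(mnm_divnK dvd_m); apply/eqP/eqP => [e|-> //].
apply/mnmP => i; move/mnmP/(_ i): e; rewrite !mulmnE => /eqP.
by rewrite eqn_pmul2r // => /eqP.
Qed.

Lemma frob_lift_X p m : frob_lift p (frob p) ('X_[m] : {mpoly R[N]}).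
Proof. by rewrite /frob_lift /= frobX mpolyXn subrr; exact: divn_by0. Qed.

Definition deg_lt (d : nat) f := forall m, (d <= mdeg m)%N -> f@_m = 0.

Lemma deg_lt_sum d (I : Type) (r : seq I) (Q : pred I)
    (F : I -> {mpoly R[N]}) :
  (forall i, Q i -> deg_lt d (F i)) -> deg_lt d (\sum_(i <- r | Q i) F i).
Proof.
move=> hF; apply: big_ind => // [m _|f g hf hg m le_dm]; first exact: mcoeff0.
by rewrite mcoeffD hf // hg // addr0.
Qed.

Lemma deg_ltN d f : deg_lt d f -> deg_lt d (- f).
Proof. by move=> hf m /hf; rewrite mcoeffN => ->; rewrite oppr0. Qed.

Lemma deg_lt_le d e f : (d <= e)%N -> deg_lt d f -> deg_lt e f.
Proof. by move=> le_de hf m le_em; exact/hf/(leq_trans le_de). Qed.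

Lemma deg_ltM d e f g :
  deg_lt d.+1 f -> deg_lt e.+1 g -> deg_lt (d + e).+1 (f * g).
Proof.
move=> hf hg m lt_m; rewrite mcoeffM big1 // => -[k1 k2] /= /eqP ek.
have [lt_d|le_d] := ltnP d (mdeg k1); first by rewrite hf ?mul0r.
rewrite hg ?mulr0 // ltnNge; apply/negP => le_e.
by move: lt_m; rewrite ek mdegD ltnNge leq_add.
Qed.

Lemma deg_ltX d f n : deg_lt d.+1 f -> deg_lt (d * n).+1 (f ^+ n).
Proof.
move=> hf; elim: n => [|n IHn]; last by rewrite exprS mulnS; exact: deg_ltM.
move=> m; rewrite muln0 expr0 mcoeff1 => m_gt0.
by rewrite -mdeg_eq0 eqn0Ngt m_gt0.
Qed.

Lemma deg_lt_frob d q f : deg_lt d.+1 f -> deg_lt (q * d).+1 (frob q f).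
Proof.
case: (posnP q) => [->|q_gt0] hf m le_m.
  rewrite frobE raddf_sum /= big1 // => k _.
  rewrite mcoeffZ mcoeffX; case: eqP => [e|]; last by rewrite mulr0.
  by move: le_m; rewrite -e mdegMn !muln0.
rewrite mcoeff_frob //; case: ifP => // dvd_m; apply: hf.
by move: le_m; rewrite -{1}(mnm_divnK dvd_m) mdegMn mulnC ltn_pmul2r.
Qed.

End Frob.

Section ConstantTerm.
Variables (n N : nat) (u : 'I_N -> 'rV[int]_n) (R : comNzRingType).
Implicit Types (f g : {mpoly R[N]}) (m k : 'X_{1..N}) (q : nat).

(* [y_I = a_I t^{u_I}] generate a polynomial ring in which the exponent of [t]
   in a monomial [y^m] is determined by [m]: Laurent polynomials in [t] are
   never needed. *)
Definition texp m : 'rV[int]_n := \sum_I u I *+ m I.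

Lemma texpD m k : texp (m + k)%MM = texp m + texp k.
Proof.
by rewrite -big_split; apply: eq_bigr => I _; rewrite mnmDE mulrnDr.
Qed.

Lemma texpMn m q : texp (m *+ q)%MM = texp m *+ q.
Proof.
by rewrite -sumrMnl; apply: eq_bigr => I _; rewrite mulmnE mulrnA.
Qed.

Lemma texpU I : texp U_(I)%MM = u I.
Proof.
rewrite /texp (bigD1 I) //= mnm1E eqxx mulr1n big1 ?addr0 // => J ne.
by rewrite mnm1E eq_sym (negPf ne) mulr0n.
Qed.

Lemma texp0 : texp 0%MM = 0.
Proof. by rewrite /texp big1 // => I _; rewrite mnm0E mulr0n. Qed.

Definition cterm f : {mpoly R[N]} :=
  \sum_(m <- msupp f | texp m == 0) f@_m *: 'X_[m].

Lemma mcoeff_cterm f m : (cterm f)@_m = if texp m == 0 then f@_m else 0.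
Proof.
rewrite /cterm raddf_sum /=.
under eq_bigr => k _ do rewrite mcoeffZ mcoeffX.
case: ifP => [m0|mN0].
  rewrite [in RHS](mpolyE f) raddf_sum /= big_mkcond; apply: eq_bigr => k _.
  rewrite mcoeffZ mcoeffX; case: (k =P m) => [->|_]; first by rewrite m0.
  by rewrite mulr0 if_same.
rewrite big1 // => k k0; case: eqP => [e|]; last by rewrite mulr0.
by rewrite -e k0 in mN0.
Qed.

Fact cterm_is_additive : additive cterm.
Proof.
move=> f g; apply/mpolyP => m; rewrite mcoeffB !mcoeff_cterm mcoeffB.
by case: ifP; rewrite ?subr0.
Qed.
HB.instance Definition _ :=
  GRing.isAdditive.Build _ _ cterm cterm_is_additive.

Lemma cterm1 : cterm 1 = 1.
Proof.
apply/mpolyP => m; rewrite mcoeff_cterm mcoeff1.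
by case: (m =P 0%MM) => [->|_]; rewrite ?texp0 ?eqxx ?if_same.
Qed.

(* [- texp k] is interior to the polytope if its [q]-th multiple lies in the
   dilate by [q - 1]. *)
Definition unique_interior := forall m k q, (mdeg m < q)%N ->
  texp m + texp k *+ q = 0 -> texp k = 0.

(** If [y^m] from [f] times the [q]-th power of [y^l] from [g] is free of [t], then [mdeg m < q]
    forces [texp l = 0], hence [texp m = 0]: each factor is already free of [t]. *)
Lemma ctermM_frob f g q : unique_interior -> (0 < q)%N -> deg_lt q f ->
  cterm (f * frob q g) = cterm f * frob q (cterm g).
Proof.
move=> u_int q_gt0 hf; apply/mpolyP => k; rewrite mcoeff_cterm !mcoeffM.
suff ct k1 k2 : k = (k1 + k2)%MM ->
    (if texp k == 0 then f@_k1 * (frob q g)@_k2 else 0) =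
    (cterm f)@_k1 * (frob q (cterm g))@_k2.
  case: ifP ct => k0 ct; first by apply: eq_bigr => l /eqP /ct.
  by rewrite big1 // => l /eqP /ct.
move=> ->; rewrite !mcoeff_frob // mcoeff_cterm.
case: (boolP [forall i, q %| k2 i]%N) => [dvd_k2|_]; last first.
  by rewrite !mulr0 if_same.
have [lt_q|/hf ->] := ltnP (mdeg k1) q; last by rewrite mul0r !if_same mul0r.
rewrite mcoeff_cterm -{1}(mnm_divnK dvd_k2) texpD texpMn.
set l := mnm_divn q k2.
have [l0|lN0] := eqVneq (texp l) 0.
  by rewrite l0 mul0rn addr0; case: ifP; rewrite ?mul0r.
rewrite mulr0; case: eqP => // /(u_int _ _ _ lt_q) /eqP.
by rewrite (negPf lN0).
Qed.

End ConstantTerm.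

Section TruncatedPeriod.
Variables (n N : nat) (u : 'I_N -> 'rV[int]_n) (R : comNzRingType).
Variables (p : nat) (p_pr : prime p).
Hypothesis u_int : unique_interior u.
Implicit Types (f g : {mpoly R[N]}) (m k : 'X_{1..N}).

Let p_gt0 : (0 < p)%N := prime_gt0 p_pr.
Let pX_gt0 s : (0 < p ^ s)%N. Proof. by rewrite expn_gt0 p_gt0. Qed.

Definition minus_sum_vars : {mpoly R[N]} := - \sum_I 'X_I.
Local Notation x := minus_sum_vars.

(** [mstrunc_period] identifies this with the truncation of the period at degree [p ^ s - 1]. *)
Definition trunc_period s : {mpoly R[N]} := cterm u (geom_sum x (p ^ s)).

Lemma frob_lift_vars : frob_lift p (frob p) x.
Proof.
apply: (frob_liftN p_pr); apply: (frob_lift_sum p_pr) => I _.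
exact: frob_lift_X.
Qed.

Lemma deg_lt_vars : deg_lt 2 x.
Proof.
apply/deg_ltN/deg_lt_sum => I _ m; rewrite mcoeffX.
by case: eqP => // <-; rewrite mdeg1.
Qed.

Lemma deg_lt_geom_sum s : deg_lt (p ^ s) (geom_sum x (p ^ s)).
Proof.
rewrite /geom_sum big_mkord; apply: deg_lt_sum => i _.
by apply: (deg_lt_le _ (deg_ltX deg_lt_vars)); rewrite mul1n.
Qed.

Lemma trunc_period_decomp S : exists C : nat -> {mpoly R[N]},
  (forall s, (0 < s <= S)%N -> trunc_period s =
     \sum_(i < s) C i * frob (p ^ i.+1) (trunc_period (s - i.+1))) /\
  forall i, (i < S)%N -> divn_by (p ^ i) (C i).
Proof.
have [f|l f||A [decA divA]] :=
    @geom_sum_decomp _ p (fun l => frob (p ^ l)) _ _ x _ S.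
- exact: frob1.
- by rewrite /= frob_frob expnS expn1.
- by rewrite expn1; exact: frob_lift_vars.
(* This is the degree bound that [ctermM_frob] requires. In the identity solved for [A i], the
   products have degree at most [(p ^ j.+1 - 1) + p ^ j.+1 * (p ^ (i - j) - 1) = p ^ i.+1 - 1]. *)
have degA i : (i < S)%N -> deg_lt (p ^ i.+1) (A i).
  have [m] := ubnP i; elim: m i => // m IHm i lt_im lt_iS.
  have := decA i.+1 lt_iS; rewrite big_ord_recr /= subnn expn0 geom_sum1.
  rewrite rmorph1 mulr1 => /esym /(canRL (addKr _)) ->.
  rewrite addrC.
  move=> k le_k; rewrite mcoeffB deg_lt_geom_sum // sub0r.
  apply/eqP; rewrite oppr_eq0; apply/eqP; move: k le_k.
  apply: deg_lt_sum => -[j lt_ji] _ /=.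
  have hA : deg_lt (p ^ j.+1).-1.+1 (A j).
    by rewrite prednK //; apply: IHm; lia.
  have hG : deg_lt (p ^ (i.+1 - j.+1)).-1.+1 (geom_sum x (p ^ (i.+1 - j.+1))).
    by rewrite prednK //; exact: deg_lt_geom_sum.
  apply: (deg_lt_le _ (deg_ltM hA (deg_lt_frob hG))).
  by rewrite -addSn prednK // -mulnS prednK // -expnD subnKC // ltnW.
exists (fun i => cterm u (A i)); split=> [s /andP [s_gt0 le_sS]|i lt_iS].
  rewrite /trunc_period {1}decA ?s_gt0 // raddf_sum; apply: eq_bigr => i _ /=.
  by rewrite ctermM_frob //; apply: degA; exact: leq_trans le_sS.
exact/divn_by_morph/divA.
Qed.

Lemma trunc_period0 : trunc_period 0 = 1.
Proof. by rewrite /trunc_period expn0 geom_sum1 cterm1. Qed.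

(** The decomposition twisted by [frob (p ^ i)] is the recursion of [composition_det]; the left ends
    [0] and [1] give this determinant. *)
Lemma dwork_congruence_trunc s r : (s <= r)%N ->
  divn_by (p ^ s.+1)
    (trunc_period s.+1 * frob p (trunc_period r) -
     trunc_period r.+1 * frob p (trunc_period s)).
Proof.
move=> le_sr; have [C [decC divC]] := trunc_period_decomp r.+1.
have := @composition_det _ p r.+1
  (fun i j => frob (p ^ i) (trunc_period (j - i)))
  (fun i l => frob (p ^ i) (C (l - i)%N)) _ _ 0 1 s.+1 isT.
rewrite !subSS !subn0 !expn0 !expn1 !frob1; apply=> //.
- move=> i j /andP [lt_ij le_jr]; rewrite decC; last by lia.
  rewrite raddf_sum -[in RHS](add0n i) big_addn big_mkord add0n.
  apply: eq_bigr => l _ /=.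
  rewrite addnK rmorphM /= frob_frob -expnD.
  by rewrite -subnDA !addnS addnC.
- move=> i l /andP [le_il lt_lr]; apply: (@divn_by_morph _ _ (frob (p ^ i))).
  by apply: divC; exact: leq_ltn_trans (leq_subr _ _) lt_lr.
Qed.

End TruncatedPeriod.

(** * Coefficients of the period *)

Section PeriodCoefficients.
Variables (n N : nat) (u : 'I_N -> 'rV[int]_n).
Implicit Types (m k : 'X_{1..N}).

Lemma mcoeffXUM (R : comNzRingType) (f : {mpoly R[N]}) I m :
  ('X_I * f)@_m = if m I != 0%N then f@_(m - U_(I))%MM else 0.
Proof.
rewrite mulrC; case: ifPn => [mI|mI].
  by rewrite -{1}(submK (_ : U_(I) <= m)%MM) ?lep1mP // addmC mcoeffMX.
apply: memN_msupp_eq0; rewrite (perm_mem (msuppMX _ _)).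
apply: contra mI => /mapP [k _ ->].
by rewrite mnmDE mnm1E eqxx.
Qed.

Lemma texp_subU I m : m I != 0%N -> texp u (m - U_(I))%MM = texp u m - u I.
Proof.
move=> mI; rewrite -{2}(submK (_ : U_(I) <= m)%MM) ?lep1mP //.
by rewrite texpD texpU addrK.
Qed.

(** The exponent of [t] is a function of the monomial in the [a_I], so extracting the coefficient of
    [t^w] only selects monomials. *)
Lemma mcoeff_laurent_pow d w m : (laurent_pow u d w)@_m =
  if texp u m == w then ((\sum_I 'X_I : {mpoly int[N]}) ^+ d)@_m else 0.
Proof.
elim: d w m => [|d IHd] w m.
  rewrite expr0 mcoeff1 /=; case: (m =P 0%MM) => [->|/eqP mN0].
    by rewrite texp0 [w == 0]eq_sym; case: eqP; rewrite ?mcoeff1 ?eqxx ?mcoeff0.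
  by case: (w == 0); rewrite ?mcoeff0 ?mcoeff1 ?(negPf mN0) if_same.
rewrite exprS mulr_suml /= !raddf_sum /=.
have [e|ne] := eqVneq; [|rewrite big1 //]; last first.
  move=> I _; rewrite mcoeffXUM IHd; case: ifP => // mI.
  by rewrite texp_subU // (inj_eq (addIr _)) (negPf ne).
apply: eq_bigr => I _; rewrite !mcoeffXUM IHd; case: ifP => // mI.
by rewrite texp_subU // e eqxx.
Qed.

Lemma mcoeff_sum_vars_pow (R : comNzRingType) d m :
  mdeg m != d -> ((\sum_I 'X_I : {mpoly R[N]}) ^+ d)@_m = 0.
Proof.
elim: d m => [|d IHd] m; first by rewrite mdeg_eq0 expr0 mcoeff1 => /negPf ->.
move=> ne; rewrite exprS mulr_suml raddf_sum /= big1 // => I _.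
rewrite mcoeffXUM; case: ifP => // mI; apply: IHd.
apply: contra ne => /eqP <-; rewrite -{1}(submK (_ : U_(I) <= m)%MM) ?lep1mP //.
by rewrite mdegD mdeg1 addn1.
Qed.

Lemma mcoeff_signM (R : comNzRingType) d (f : {mpoly R[N]}) m :
  ((-1) ^+ d * f)@_m = (-1) ^+ d * f@_m.
Proof.
rewrite -[in LHS]signr_odd -[in RHS]signr_odd.
by case: odd; rewrite ?expr1 ?expr0 ?mulN1r ?mul1r ?mcoeffN.
Qed.

(** The [k]-th power is homogeneous of degree [k]: in both sums only [k = mdeg m] can contribute, so
    their different ranges agree once [mdeg m < p ^ s]. *)
Lemma mstrunc_period (R : comNzRingType) p s : prime p ->
  mstrunc (p ^ s - 1) (map_mseries intr (period u)) = trunc_period u R p s.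
Proof.
move=> p_pr; have pX_gt0 : (0 < p ^ s)%N by rewrite expn_gt0 prime_gt0.
apply/mpolyP => m; rewrite mstruncE mcoeff_cterm /=.
rewrite /geom_sum big_mkord [(\sum_(i < _) _ ^+ i)@_m]raddf_sum /=.
pose c d : int := ((-1) ^+ d * (\sum_I 'X_I : {mpoly int[N]}) ^+ d)@_m.
have cE d : (minus_sum_vars N R ^+ d)@_m = (c d)%:~R.
  rewrite -mcoeff_map_mpoly rmorphM !rmorphXn rmorphN1 rmorph_sum /=.
  under [in RHS]eq_bigr => I _ do rewrite map_mpolyX.
  by rewrite -exprNn.
have c0 d : mdeg m != d -> c d = 0.
  by move=> ne; rewrite /c mcoeff_signM mcoeff_sum_vars_pow // mulr0.
rewrite -ltnS subn1 prednK //.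
have [lt_m|le_m] := ltnP; last first.
  rewrite big1 ?if_same // => i _; rewrite cE c0 //.
  by rewrite neq_ltn (leq_trans (ltn_ord i)) ?orbT.
rewrite (big_ord_widen _ (fun d => (-1) ^+ d * (laurent_pow u d 0)@_m) lt_m).
case: ifPn => [t0|/negPf tN0]; last first.
  by rewrite big1 // => i _; rewrite mcoeff_laurent_pow tN0 mulr0.
rewrite rmorph_sum big_mkcond; apply: eq_bigr => i _ /=.
rewrite cE mcoeff_laurent_pow t0 -mcoeff_signM -/(c i); case: ifPn => // le_i.
by rewrite c0 // neq_ltn; move: le_i; rewrite -leqNgt => ->.
Qed.

End PeriodCoefficients.

(** [frob p] fixes the coefficients, and an integer is congruent to its [p]-th power modulo [p]. *)
Lemma frob_lift_int_coef (N : nat) (R : comNzRingType) p (f : {mpoly R[N]}) :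
  prime p -> (forall m, exists z : int, f@_m = z%:~R) ->
  frob_lift p (frob p) f.
Proof.
move=> p_pr hf; rewrite (mpolyE f).
apply: (frob_lift_sum p_pr) => m _; have [z ->] := hf m.
rewrite -mul_mpolyC rmorph_int.
apply: (frob_liftM (phi := frob p)); last exact: frob_lift_X.
exact: (frob_lift_int p_pr (frob p)).
Qed.

(** * Truncated periods modulo [p] *)

Section HasseInvariant.
Variables (n N : nat) (u : 'I_N -> 'rV[int]_n) (R : comNzRingType).
Variables (p : nat) (p_pr : prime p).
Hypothesis u_int : unique_interior u.
Local Notation P s := (trunc_period u R p s).

(** Modulo [p] only the term of index [0] survives, and the decomposition of [P 1], with [P 0 = 1],
    identifies [C 0] with [P 1]. *)
Lemma trunc_periodS_mod s : divn_by p (P s.+1 - P 1 * frob p (P s)).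
Proof.
have [C [decC divC]] := trunc_period_decomp R p_pr u_int s.+1.
rewrite (decC s.+1) ?leqnn // (decC 1) //.
rewrite big_ord_recl big_ord1 !subSS !subn0 (trunc_period0 u R) rmorph1 mulr1.
rewrite expn1 addrC addrA addNr add0r; apply: divn_by_sum => i _.
apply: divn_byMr; apply: (@divn_by_dvdn _ (p ^ i.+1)).
  by rewrite expnS dvdn_mulr.
by apply: divC; rewrite ltnS.
Qed.

Lemma frob_lift_trunc_period s : frob_lift p (frob p) (P s).
Proof.
apply: frob_lift_int_coef => // m.
rewrite -mstrunc_period // mstruncE; case: ifP => _; last by exists 0.
by exists (mscoef (period u) m).
Qed.

Lemma trunc_period_mod s : exists e, divn_by p (frob p (P s) - P 1 ^+ e).
Proof.
elim: s => [|s [e IHs]].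
  by exists 0; rewrite trunc_period0 rmorph1 subrr; exact: divn_by0.
(* Modulo [p], [frob p (P s.+1) = P s.+1 ^+ p = (P 1 * frob p (P s)) ^+ p = (P 1 ^+ e.+1) ^+ p]. *)
exists (e.+1 * p)%N; rewrite exprM.
apply: (divn_by_trans (frob_lift_trunc_period s.+1)); apply: divn_by_subX.
apply: (divn_by_trans (trunc_periodS_mod s)).
by rewrite exprS -mulrBr; exact: divn_byMl.
Qed.

End HasseInvariant.

(** * Completed localizations of polynomial rings *)

Section SeriesTheory.
Variables (N : nat) (R : comNzRingType).
Local Notation S := (mseries N R).
Local Notation ser := (@series_of_mpoly N R).
Implicit Types (f g : S) (q h : {mpoly R[N]}) (m : 'X_{1..N}).

Lemma mscoefM f g q q' m :
    (forall k, (mdeg k <= mdeg m)%N -> mscoef f k = q@_k) ->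
    (forall k, (mdeg k <= mdeg m)%N -> mscoef g k = q'@_k) ->
  mscoef (f * g) m = (q * q')@_m.
Proof.
move=> hf hg; rewrite [LHS]mscoef_mul.
by apply: mcoeffM_congr => k le_k; rewrite mstruncE le_k ?hf ?hg.
Qed.

Lemma mscoefMn f c m : mscoef (f *+ c) m = mscoef f m *+ c.
Proof.
elim: c => [|c IHc]; first by rewrite !mulr0n /= mcoeff0.
by rewrite !mulrS -IHc.
Qed.

Fact series_of_mpoly_is_additive : additive ser.
Proof. by move=> q h; apply/mseriesP => m /=; rewrite mcoeffB. Qed.
HB.instance Definition _ :=
  GRing.isAdditive.Build _ _ ser series_of_mpoly_is_additive.

Fact series_of_mpoly_is_multiplicative : multiplicative ser.
Proof.
split=> // q h; apply/mseriesP => m.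
by rewrite (@mscoefM _ _ q h).
Qed.
HB.instance Definition _ :=
  GRing.isMultiplicative.Build _ _ ser series_of_mpoly_is_multiplicative.

Lemma divn_by_mscoef c f : (forall m, divn_by c (mscoef f m)) -> divn_by c f.
Proof.
move=> /choice [d hd]; exists (MSeries d).
by apply/mseriesP => m; rewrite mscoefMn hd.
Qed.

Lemma congr_modTP c f g : congr_mod (fun=> True) c f g <-> divn_by c (f - g).
Proof. by split=> [[d _ e]|[d e]]; exists d. Qed.

Section Localization.
Variable h : {mpoly R[N]}.
Local Notation inloc := (in_localization h).

Lemma in_localization_poly q : inloc (ser q).
Proof. by exists q, 0; rewrite expr0 mul1r. Qed.

Lemma in_localizationM f g : inloc f -> inloc g -> inloc (f * g).
Proof.
move=> [q [k e]] [q' [k' e']]; exists (q * q'), (k + k')%N.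
by rewrite exprD mulrACA e e' rmorphM.
Qed.

Lemma in_localizationX f k : inloc f -> inloc (f ^+ k).
Proof.
move=> hf; elim: k => [|k IHk]; last by rewrite exprS; exact: in_localizationM.
by rewrite expr0 -(rmorph1 ser); exact: in_localization_poly.
Qed.

Lemma in_localizationD f g : inloc f -> inloc g -> inloc (f + g).
Proof.
move=> [q [k e]] [q' [k' e']]; exists (h ^+ k' * q + h ^+ k * q'), (k + k')%N.
by rewrite rmorphD !rmorphM !rmorphXn /= -e -e' exprD; ring.
Qed.

Lemma in_localizationB f g : inloc f -> inloc g -> inloc (f - g).
Proof.
move=> hf hg; rewrite -mulN1r -(rmorph1 ser) -rmorphN.
by apply/in_localizationD/in_localizationM => //; exact: in_localization_poly.
Qed.

Lemma in_localization_sum (I : Type) (r : seq I) (F : I -> S) :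
  (forall i, inloc (F i)) -> inloc (\sum_(i <- r) F i).
Proof.
move=> hF; apply: big_ind => //; last exact: in_localizationD.
by rewrite -(rmorph0 ser); exact: in_localization_poly.
Qed.

Lemma in_localizationV : h@_0%MM = 1 -> inloc (msinv (ser h)).
Proof. by move=> h0; exists 1, 1; rewrite expr1 msmulV // rmorph1. Qed.

(** As [c] is regular, [h ^+ k * f] vanishes in every degree where its multiple [q] does, so it is a
    polynomial. *)
Lemma in_localization_sat c f : (forall a : R, a *+ c = 0 -> a = 0) ->
  inloc (f *+ c) -> inloc f.
Proof.
move=> c_reg [q [k e]]; exists (mstrunc (msize q) (ser h ^+ k * f)), k.
apply/mseriesP => m; rewrite [RHS]mstruncE; case: leqP => // lt_m.
apply: c_reg; rewrite -mscoefMn -mulrnAr e.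
by apply: memN_msupp_eq0; apply: msize_mdeg_ge; exact: ltnW.
Qed.

Section Completion.
Variables (p : nat).
Hypothesis p_reg : forall a : R, a *+ p = 0 -> a = 0.

Let pX_reg s (a : R) : a *+ (p ^ s) = 0 -> a = 0.
Proof.
elim: s a => [|s IHs] a; first by rewrite expn0 mulr1n.
by rewrite expnS mulrnA => /IHs /p_reg.
Qed.

(** Saturation makes approximations of [g] automatically compatible inside the localization. *)
Lemma in_completed_localizationP g : in_completed_localization p h g <->
  forall s, exists2 f, inloc f & divn_by (p ^ s) (g - f).
Proof.
split=> [[f [hf _ hg]] s|H].
  by exists (f s) => //; apply/congr_modTP.
have /choice [f hf] : forall s, exists f, inloc f /\ divn_by (p ^ s) (g - f).
  by move=> s; have [f ? ?] := H s; exists f.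
exists f; split=> s; [exact: (hf s).1 | |
                      by apply/congr_modTP; exact: (hf s).2].
have [d ed] : divn_by (p ^ s) (f s.+1 - f s).
  apply: divn_by_trans (hf s).2; apply/divn_by_sym.
  exact: divn_by_exp (leqnSn s) (hf s.+1).2.
exists d => //; apply: (in_localization_sat (c := p ^ s)).
  by move=> a; exact: pX_reg.
by rewrite -ed; apply: in_localizationB; exact: (hf _).1.
Qed.

Lemma in_completed_localizationB f g : in_completed_localization p h f ->
  in_completed_localization p h g -> in_completed_localization p h (f - g).
Proof.
rewrite !in_completed_localizationP => hf hg s.
have [f' hf' df] := hf s; have [g' hg' dg] := hg s.
exists (f' - g'); first exact: in_localizationB.
have -> : f - g - (f' - g') = f - f' - (g - g') by ring.
exact: divn_byB.
Qed.

(** An approximation of [f *+ (p ^ s)] modulo [p ^ (s + k)] is itself a multiple of [p ^ s]; its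
    quotient stays in the localization and approximates [f] modulo [p ^ k]. *)
Lemma in_completed_localization_sat s f :
  in_completed_localization p h (f *+ (p ^ s)) ->
  in_completed_localization p h f.
Proof.
rewrite !in_completed_localizationP => hf k.
have [f' hf' [d ed]] := hf (s + k)%N; rewrite expnD mulnC mulrnA in ed.
have ef' : f' = (f - d *+ (p ^ k)) *+ (p ^ s).
  by rewrite mulrnBl -ed opprB addrC subrK.
exists (f - d *+ (p ^ k)).
  by apply: (in_localization_sat (c := p ^ s)); [exact: pX_reg | rewrite -ef'].
by rewrite opprB addrC subrK; exists d.
Qed.

(* If [D] is a power of [h] modulo [p], then [1 / D] is a geometric series in
   [p / h]. *)
Lemma in_completed_localization_div q D e : h@_0%MM = 1 -> D@_0%MM = 1 ->
  divn_by p (D - h ^+ e) ->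
  in_completed_localization p h (ser q * msinv (ser D)).
Proof.
move=> h0 D0 [r er]; apply/in_completed_localizationP => s.
pose v := msinv (ser h) ^+ e; pose y := 1 - ser D * v.
have hv : inloc v by apply/in_localizationX/in_localizationV.
have hy : inloc y.
  rewrite /y -(rmorph1 ser); apply: in_localizationB.
    exact: in_localization_poly.
  by apply: in_localizationM => //; exact: in_localization_poly.
have vh : ser h ^+ e * v = 1 by rewrite -exprMn msmulV // expr1n.
have py : divn_by p y.
  rewrite /y -vh -rmorphXn -mulrBl -rmorphB /=; apply: divn_byMr.
  apply: (divn_by_morph ser); apply: divn_by_sym; exact: ex_intro er.
exists (ser q * (v * \sum_(i < s) y ^+ i)).
  apply: in_localizationM; first exact: in_localization_poly.
  by apply: in_localizationM => //; apply: in_localization_sum => i;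
     exact: in_localizationX.
rewrite -mulrBr; apply: divn_byMl.
have Dv : ser D * msinv (ser D) = 1 by rewrite msmulV.
(* Since [1 / D = v / (1 - y)], this is the remainder of the geometric series. *)
have -> : msinv (ser D) - v * (\sum_(i < s) y ^+ i) = msinv (ser D) * y ^+ s.
  have ys : (1 - y) * \sum_(i < s) y ^+ i = 1 - y ^+ s.
    rewrite -[X in _ = X - _](expr1n _ s) subrXX; congr (_ * _).
    by apply: eq_bigr => i _; rewrite expr1n mul1r.
  rewrite -[v]mul1r -Dv [ser D * _]mulrC -mulrA -mulrA.
  rewrite -{1}[msinv _]mulr1 -mulrBr; congr (_ * _).
  have -> : ser D * (v * \sum_(i < s) y ^+ i) = 1 - y ^+ s.
    by rewrite -ys /y; ring.
  by rewrite opprB addrC subrK.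
apply: divn_byMl; elim: s => [|s IHs]; last first.
  by rewrite exprS expnS; exact: divn_byM.
by rewrite expn0; exists (y ^+ 0).
Qed.

End Completion.
End Localization.
End SeriesTheory.

(** Multiplication by [p] costs one digit: the residue modulo [p ^ s] is read off from the one
    modulo [p ^ s.+1]. *)
Lemma padic_mulrp_eq0 (p : nat) (p_pr : prime p) (x : padic p_pr) :
  x *+ p = 0 -> x = 0.
Proof.
move=> xp; apply/padicP => s; rewrite residueP [RHS]mod0z.
have resMn c t : residue (x *+ c) t = (residue x t *+ c %% (p ^ t)%N%:Z)%Z.
  elim: c => [|c IHc] //; rewrite !mulrS /= IHc modzDmr //.
have := resMn p s.+1; rewrite xp [LHS]mod0z => /esym/eqP.
rewrite -mulr_natr => /eqP /dvdz_mod0P; rewrite expnSr PoszM natz.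
rewrite dvdz_mul2r; last by rewrite -lt0n prime_gt0.
by move=> /dvdz_mod0P.
Qed.


(** * The interior lattice points of the anticanonical polytope *)

Section FanGeometry.
Variables (R : realType) (n : nat) (X : fan_data n).

Lemma dotv_realv (v w : 'rV[int]_n) :
  dotv (realv R v) (realv R w) = (dotv v w)%:~R.
Proof. by rewrite rmorph_sum; apply: eq_bigr => i _; rewrite !mxE rmorphM. Qed.

(** Some cone contains [w], so [w] is a nonnegative combination of rays and its pairing with itself
    is nonpositive. *)
Lemma complete_fan_nonpos (w : 'rV[int]_n) : complete_fan R X ->
  (forall i, dotv w (@ray n X i) <= 0) -> w = 0.
Proof.
move=> X_complete w_le0; have [s _ [c c_ge0 ew]] := X_complete (realv R w).
have ww_le0 : dotv (realv R w) (realv R w) <= 0.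
  rewrite {2}ew /dotv.
  under eq_bigr => j _ do rewrite summxE mulr_sumr.
  rewrite exchange_big /=; apply: sumr_le0 => i _.
  under eq_bigr => j _ do rewrite [X in _ * X]mxE mulrCA.
  rewrite -mulr_sumr mulr_ge0_le0 //.
  rewrite -[X in X <= _]/(dotv (realv R w) (realv R (ray i))).
  by rewrite dotv_realv lerz0.
move: ww_le0; rewrite dotv_realv lerz0 => ww_le0.
apply/rowP => j; rewrite mxE; apply/eqP; rewrite -sqrf_eq0 eq_le sqr_ge0 andbT.
apply: le_trans ww_le0; rewrite /dotv (bigD1 j) //= expr2 lerDl.
by apply: sumr_ge0 => k _; rewrite -expr2 sqr_ge0.
Qed.

Lemma dotv_texp N (u : 'I_N -> 'rV[int]_n) m v :
  dotv (texp u m) v = \sum_I dotv (u I) v *+ m I.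
Proof.
rewrite /dotv; under eq_bigr => j _ do rewrite summxE mulr_suml.
rewrite exchange_big /=; apply: eq_bigr => I _.
by rewrite -sumrMnl; apply: eq_bigr => j _; rewrite mulmxnE mulrnAl.
Qed.

(** Pairing with a ray gives at least [- mdeg m > - q] on [texp u m], hence less than [1] on
    [texp u k]; by integrality it is nonpositive there. *)
Lemma polytope_unique_interior N (u : 'I_N -> 'rV[int]_n) :
  complete_fan R X -> (forall I, anticanonical_polytope X (realv R (u I))) ->
  unique_interior u.
Proof.
move=> X_complete u_pol m k q lt_mq /eqP; rewrite addr_eq0 => /eqP e.
apply: complete_fan_nonpos => // i.
have u_ge I : -1 <= dotv (u I) (ray i).
  by have := u_pol I i; rewrite dotv_realv -(ler_int R) rmorphN1.
have dot_m : - (mdeg m)%:Z <= dotv (texp u m) (ray i).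
  rewrite dotv_texp mdegE -natz rmorph_sum -sumrN /=; apply: ler_sum => I _.
  rewrite natz -mulr_natr natz; have := u_ge I; nia.
have dot_k : dotv (texp u m) (ray i) = - (dotv (texp u k) (ray i) * q%:Z).
  rewrite e /dotv mulr_suml -sumrN; apply: eq_bigr => j _.
  by rewrite !mxE mulmxnE mulNr mulrnAl -mulr_natr natz.
by move: dot_m; rewrite dot_k; nia.
Qed.

End FanGeometry.

(** * Passage from the truncations to the full period *)

Theorem mainTheorem2 (R : realType) (n : nat) (X : fan_data n)
    (X_fan : is_fan R X) (X_smooth : smooth_fan X) (X_complete : complete_fan R X)
    (X_nef : anticanonical_nef X)
    (N : nat) (u : 'I_N.+1 -> 'rV[int]_n)
    (u0 : u ord0 = 0) (u_inj : injective u)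
    (u_points : forall w : 'rV[int]_n,
      anticanonical_polytope X (realv R w) <-> exists I, w = u I)
    (p : nat) (p_pr : prime p) :
  let P : mseries N (padic p_pr) :=
    map_mseries intr (period (fun I : 'I_N => u (lift ord0 I))) in
  let g : mseries N (padic p_pr) := P * msinv (mspow p P) in
  let Ahat := in_completed_localization p (mstrunc (p - 1) P) in
  Ahat g /\
  forall s : nat, (1 <= s)%N ->
    congr_mod Ahat (p ^ s) g
      (series_of_mpoly (mstrunc (p ^ s - 1) P) *
       msinv (series_of_mpoly
         (mstrunc (p ^ (s - 1) - 1) P \mPo [tuple 'X_I ^+ p | I < N]))).
Proof.
move=> P g Ahat; pose u' I := u (lift ord0 I).
pose T s := trunc_period u' (padic p_pr) p s.
have u_int : unique_interior u'.
  apply: (polytope_unique_interior X_complete) => I.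
  by apply/u_points; exists (lift ord0 I).
have p_gt0 := prime_gt0 p_pr.
have TP s : mstrunc (p ^ s - 1) P = T s by exact: mstrunc_period.
have TcoefP s m : (mdeg m < p ^ s)%N -> mscoef P m = (T s)@_m.
  move=> lt_m; rewrite -TP mstruncE -ltnS subn1 prednK ?lt_m //.
  by rewrite expn_gt0 p_gt0.
(* Exponents are divided by [p], so agreement below degree [p ^ s] becomes agreement below
   [p ^ s.+1]. *)
have TcoefPp s m : (mdeg m < p ^ s.+1)%N ->
    mscoef (mspow p P) m = (frob p (T s))@_m.
  move=> lt_m; rewrite mcoeff_frob //=; case: ifP => // dvd_m; apply: TcoefP.
  by rewrite -(ltn_pmul2r p_gt0) -mdegMn mnm_divnK // mulnC -expnS.
have T0 s : (T s)@_0%MM = 1.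
  rewrite -(TcoefP s) ?mdeg0 ?expn_gt0 ?p_gt0 //=.
  by rewrite mdeg0 big_ord1 expr0 mul1r /= eqxx mcoeff1 eqxx.
have frobT0 s : (frob p (T s))@_0%MM = 1.
  rewrite mcoeff_frob //; case: ifPn => [dvd0|/forallPn [i]].
    rewrite -(T0 s); congr _@_ _; apply/mnmP => i.
    by rewrite mnmE mnm0E div0n.
  by rewrite mnm0E dvdn0.
have Pp0 : mscoef (mspow p P) 0%MM = 1.
  by rewrite (TcoefPp 0) ?frobT0 // mdeg0 expn_gt0 p_gt0.
pose D s := series_of_mpoly (frob p (T s)).
pose Q s := series_of_mpoly (T s.+1) * msinv (D s).
have DV s : D s * msinv (D s) = 1 by rewrite msmulV /= ?frobT0.
have cross s : divn_by (p ^ s.+1)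
    (P * D s - series_of_mpoly (T s.+1) * mspow p P).
  (* The truncation index tends to infinity one coefficient at a time: this [r] satisfies [s <= r]
     and [mdeg m < p ^ r.+1], so [T r.+1] and [frob p (T r)] may replace [P] and [mspow p P]. *)
  apply: divn_by_mscoef => m; pose r := (s + mdeg m)%N.
  have lt_m : (mdeg m < p ^ r.+1)%N.
    apply: leq_trans (ltn_expl _ (prime_gt1 p_pr)) _.
    by rewrite leq_exp2l ?prime_gt1 // ltnW // ltnS leq_addl.
  have [d ed] := divn_by_sym
    (dwork_congruence_trunc (padic p_pr) p_pr u_int (leq_addr (mdeg m) s)).
  exists d@_m; rewrite -mcoeffMn -ed mcoeffB.
  rewrite -[LHS]/(mscoef (P * D s) m -
    mscoef (series_of_mpoly (T s.+1) * mspow p P) m).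
  congr (_ - _); apply: mscoefM => k le_k //.
    by apply: TcoefP; exact: leq_ltn_trans lt_m.
  by apply: TcoefPp; exact: leq_ltn_trans lt_m.
have gQ s : divn_by (p ^ s.+1) (g - Q s).
  exact: divn_by_sub_quot (msmulV Pp0) (DV s) (cross s).
have p_reg := @padic_mulrp_eq0 p p_pr.
have hT : mstrunc (p - 1) P = T 1%N by rewrite -TP expn1.
have AQ s : Ahat (Q s).
  have [e he] := trunc_period_mod (padic p_pr) p_pr u_int s.
  by rewrite /Ahat hT; apply: (in_completed_localization_div p_reg) he.
have Ag : Ahat g.
  (* [Q s] is congruent to [g] modulo [p ^ s.+1], so its approximation in the localization modulo
     [p ^ s] also serves [g]. *)
  apply/in_completed_localizationP => // s.
  have /(in_completed_localizationP _ p_reg) /(_ s) [f hf df] := AQ s.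
  exists f; first exact: hf.
  apply: divn_by_trans df.
  exact: divn_by_exp (leqnSn s) (gQ s).
split=> [|[//|s] _]; first exact: Ag.
rewrite subSS subn0 (TP s.+1) (TP s).
have [d ed] := gQ s; exists d; last exact: ed.
(* The quotient [d] is so far only a power series; saturation puts it in the completion, as
   [g - Q s] lies there. *)
apply: (in_completed_localization_sat p_reg (s := s.+1)); rewrite -ed.
by apply: in_completed_localizationB; [exact: p_reg | exact: Ag | exact: AQ].
Qed.
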